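(* Let $a, b, \mu, \nu$ be positive real numbers, and suppose that the following three conditions hold: (i) $\dfrac{\Gamma(a+2\mu)}{\Gamma(a+3\mu)}<\dfrac{\Gamma(b+3\nu)}{2\Gamma(b+2\nu)}$; (ii) $\dfrac{\Gamma(a+\mu)\Gamma(a+3\mu)}{\Gamma^2(a+2\mu)}<\dfrac{2\Gamma^2(b+2\nu)}{\Gamma(b+\nu)\Gamma(b+3\nu)}$; (iii) $\dfrac{\Gamma(a)\Gamma(b)}{\Gamma(a+\mu)\Gamma(b+\nu)}-\dfrac{(1-e)\Gamma(a)\Gamma(b)}{\Gamma(a+2\mu)\Gamma(b+2\nu)}<1$. Then the function $\mathbb{W}_{(\mu,a),(\nu,b)}(z)$ is starlike in $\mathbb{D}_{1/2}$.
   Context: $\mathbb{D}_{1/2}=\{z\in\mathbb{C}:|z|<1/2\}$. The normalized four parameters Wright function is $$\mathbb{W}_{(\mu,a),(\nu,b)}(z)=\sum_{k=0}^{\infty}\frac{\Gamma(a)\Gamma(b)}{\Gamma(a+k\mu)\Gamma(b+k\nu)}\,z^{k+1}.$$ A function $f$ analytic with $f(0)=0$, $f'(0)=1$ is starlike in a disk $D$ centered at $0$ if $f$ is univalent in $D$ and $f(D)$ is a star-shaped domain with respect to $0$; equivalently, $\Re\left(zf'(z)/f(z)\right)>0$ for all $z\in D$. *)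

(* Defs.v *)
From HB Require Import structures.
From mathcomp Require Import all_boot all_order all_algebra.
From mathcomp Require Import complex.
From mathcomp Require Import all_classical all_reals all_analysis.

Set Implicit Arguments.
Unset Strict Implicit.
Unset Printing Implicit Defensive.

Import Order.TTheory GRing.Theory Num.Theory.
Import numFieldNormedType.Exports.

Local Open Scope classical_set_scope.
Local Open Scope ring_scope.
Local Open Scope complex_scope.

(* The cast to numClosedFieldType is what lets R[i] inherit the topology and
   the normed module structure that numFieldNormedType.Exports puts on an
   arbitrary numFieldType; derivatives over it are complex derivatives. *)
Local Notation Cplx R := (R[i] : numClosedFieldType).

(* Euler's integral; it converges, and hence has its usual value, for x > 0
   only, which is the only case used below. *)
Definition Gamma (R : realType) (x : R) : R :=
  \int[lebesgue_measure]_(t in `]0, +oo[%classic) (t `^ (x - 1) * expR (- t)).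

(* The coefficient of z^(k+1). *)
Definition wright_coef (R : realType) (mu a nu b : R) (k : nat) : R :=
  (Gamma a * Gamma b) / (Gamma (a + k%:R * mu) * Gamma (b + k%:R * nu)).

Definition wright (R : realType) (mu a nu b : R) (z : Cplx R) : Cplx R :=
  limn (series (fun k : nat =>
    (wright_coef mu a nu b k)%:C * z ^+ k.+1 : Cplx R)).

Definition disk (R : realType) (r : R) : set (Cplx R) :=
  [set z | `|z| < r%:C].

Definition holomorphic_on (R : realType) (D : set (Cplx R))
    (f : Cplx R -> Cplx R) : Prop :=
  forall z, D z -> derivable f z 1.

Definition univalent_on (R : realType) (D : set (Cplx R))
    (f : Cplx R -> Cplx R) : Prop :=
  holomorphic_on D f /\ {in D &, injective f}.

Definition domain (R : realType) (S : set (Cplx R)) : Prop :=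
  [/\ S !=set0, open S & connected S].

Definition star_shaped (R : realType) (S : set (Cplx R)) : Prop :=
  S 0 /\ forall (w : Cplx R) (t : R), S w -> 0 <= t <= 1 -> S (t%:C * w).

Definition starlike_on (R : realType) (D : set (Cplx R))
    (f : Cplx R -> Cplx R) : Prop :=
  [/\ univalent_on D f, f 0 = 0, derive1 f 0 = 1, domain (f @` D)
    & star_shaped (f @` D)].

(* Main.v *)
(* Log-convexity of Gamma (Cauchy-Schwarz in Euler's integral) makes the
   denominators D k = Gamma (a + k mu) Gamma (b + k nu) log-convex in k, and (i)
   reads 2 D 2 < D 3; hence D doubles at each step from k = 2 on, and the
   coefficients c k = D 0 / D k satisfy c k <= c 2 / 2^(k-2).  With (iii) this
   gives the sum over k >= 1 of (k+1) c k / 2^k at most c 1 + (10/9) c 2 < 1, that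
   is |f' - 1| <= q < 1 on the disk of radius 1/2.  So f is the identity plus a
   q-contraction: it is injective, and open by the Banach fixed point iteration.
   For starlikeness write z' = z v with f z' = t f z, t < 1 close to 1: the same
   bound on the coefficients yields |v - t| <= |v - 1|, which forces |z'| <= |z|;
   any t > 0 is then reached by finitely many small shrinkings. *)
Require Import Defs.
From HB Require Import structures.
From mathcomp Require Import all_boot all_order all_algebra ring lra.
From mathcomp Require Import complex.
From mathcomp Require Import all_classical all_reals all_analysis.
From mathcomp Require Import measurable_realfun.

Import Order.TTheory GRing.Theory Num.Theory.
Import numFieldNormedType.Exports.
Import Normc.

Local Open Scope classical_set_scope.
Local Open Scope ring_scope.

Local Arguments normc {R} x : simpl never.

(** * Positivity and log-convexity of Gamma *)

Section GammaFunction.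
Context {R : realType}.
Implicit Types x y t : R.
Local Notation mu := (@lebesgue_measure R).

Definition gamma_fun x t : R := t `^ (x - 1) * expR (- t).

Lemma measurable_gamma_fun x (D : set R) : measurable_fun D (gamma_fun x).
Proof.
apply: measurable_funTS.
apply: measurable_funM; first exact: measurable_powR.
apply: (measurableT_comp (@measurable_expR R)).
exact: measurable_funN.
Qed.

Lemma gamma_fun_ge0 x t : 0 <= gamma_fun x t.
Proof. by rewrite mulr_ge0 ?powR_ge0 ?expR_ge0. Qed.

(** The antiderivative is t^x / x; the lower end stays away from 0, where the integrand is singular
    for x < 1. *)
Lemma integral_powR_itvcc x (e : R) : 0 < x -> 0 < e < 1 ->
  (\int[mu]_(t in `[e, 1%R]) (t `^ (x - 1))%:E = ((1 - e `^ x) / x)%:E)%E.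
Proof.
move=> x0 /andP[e0 e1].
have dP (z : R) : 0 < z -> is_derive z 1 (fun t : R => x^-1 * t `^ x) (z `^ (x - 1)).
  move=> z0.
  have dz : is_derive z 1 (@powR R ^~ x) (x * z `^ (x - 1)).
    apply: DeriveDef.
      by apply: derivable_powR; rewrite in_itv/= z0.
    by rewrite -derive1E powR_derive1// in_itv/= z0.
  have := is_deriveZ x^-1 dz.
  by rewrite /GRing.scale/= mulKf ?gt_eqF.
have cP (z : R) : 0 < z -> {for z, continuous (@powR R ^~ (x - 1))}.
  move=> z0; apply: differentiable_continuous; apply/derivable1_diffP.
  by apply: derivable_powR; rewrite in_itv/= z0.
rewrite (@continuous_FTC2 _ _ (fun t : R => x^-1 * t `^ x))//.
- by rewrite powR1 -EFinB -mulrBr mulrC.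
- apply: continuous_in_subspaceT => z; rewrite inE/= in_itv/= => /andP[ez _].
  by apply: cP; exact: lt_le_trans ez.
- have cQ (z : R) : 0 < z -> {for z, continuous (fun t : R => x^-1 * t `^ x)}.
    move=> z0; apply: differentiable_continuous; apply/derivable1_diffP.
    by have [] := dP z z0.
  split.
  + by move=> z; rewrite in_itv/= => /andP[ez _]; have [] := dP z (lt_trans e0 ez).
  + by apply: cvg_at_right_filter; exact: cQ.
  + by apply: cvg_at_left_filter; apply: cQ; rewrite ltr01.
- move=> z; rewrite in_itv/= => /andP[ez _]; rewrite derive1E.
  by have [_ ->] := dP z (lt_trans e0 ez).
Qed.

(** Monotone convergence along closed intervals exhausting the half-open one; each integral is at
    most 1 / x, uniformly in the lower end. *)
Lemma integral_powR_lty x : 0 < x ->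
  (\int[mu]_(t in `]0%R, 1%R]) (t `^ (x - 1))%:E < +oo)%E.
Proof.
move=> x0.
pose E (n : nat) : set R := `[n.+2%:R^-1, 1]%classic.
have UE : `]0%R, 1%R]%classic = \bigcup_n E n.
  apply/seteqP; split => t /=; rewrite in_itv/=.
    move=> /andP[t0 t1].
    exists (Num.truncn t^-1) => //=; rewrite /E/= in_itv/= t1 andbT.
    rewrite invf_ple ?posrE//.
    by apply/ltW/(lt_trans (truncnS_gt _)); rewrite ltr_nat.
  move=> [n _]; rewrite /E/= in_itv/= => /andP[nt ->]; rewrite andbT.
  by apply: lt_le_trans nt; rewrite invr_gt0 ltr0n.
have ndE : nondecreasing_seq E.
  apply/nondecreasing_seqP => n; apply/subsetPset => t; rewrite /E/= !in_itv/=.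
  move=> /andP[nt ->]; rewrite andbT; apply: le_trans nt.
  by rewrite lef_pV2 ?posrE ?ltr0n// ler_nat.
have mp (D : set R) : measurable_fun D (fun t => (t `^ (x - 1))%:E).
  by apply/measurable_EFinP; apply: measurable_funTS; exact: measurable_powR.
have cv : (\int[mu]_(t in E n) (t `^ (x - 1))%:E @[n --> \oo]
            --> \int[mu]_(t in \bigcup_n E n) (t `^ (x - 1))%:E)%E.
  apply: ge0_nondecreasing_set_cvg_integral => //.
    by move=> i; exact: measurable_itv.
    by move=> i; exact: mp.
  by move=> i t Et; rewrite lee_fin powR_ge0.
rewrite UE; apply: (@le_lt_trans _ _ (x^-1)%:E); last by rewrite ltry.
rewrite -(cvg_lim _ cv)//; apply: lime_le; first by apply/cvg_ex; eexists; exact: cv.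
apply: nearW => n; rewrite integral_powR_itvcc//.
  by rewrite lee_fin -[leRHS]mul1r ler_pM2r ?invr_gt0// gerBl powR_ge0.
by rewrite invr_gt0 ltr0n/= invf_lt1 ?ltr0n// ltr1n.
Qed.

(** Half of the exponential decay absorbs the power; the other half is, up to a constant, the
    exponential density of rate 1/2, whose integral is known to be finite. *)
Lemma gamma_fun_exp_bound x : exists2 C : R, 0 <= C &
  forall t, 1 <= t -> gamma_fun x t <= C * exponential_pdf (1 / 2) t.
Proof.
pose n := (Num.truncn `|x|).+1.
have xn : x - 1 <= n%:R.
  have := truncnS_gt `|x|; rewrite -/n => h.
  have := ler_norm x; lra.
exists (2 * (2 ^+ n * n`!%:R)) => [|t t1].
  by rewrite !mulr_ge0 ?exprn_ge0 ?ler0n.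
have t0 : 0 <= t by apply: le_trans t1.
rewrite /exponential_pdf patchE mem_set/=; last by rewrite in_itv/= t0.
rewrite /gamma_fun.
(* From the term of degree [n] in the exponential series at t / 2. *)
have tn : t ^+ n <= 2 ^+ n * n`!%:R * expR (t / 2).
  have h2 : 0 <= t / 2 by lra.
  have := expR_ge1Dxn n.-1 h2; rewrite prednK// => h.
  have {h} : (t / 2) ^+ n / n`!%:R <= expR (t / 2) by lra.
  rewrite ler_pdivrMr ?ltr0n ?fact_gt0// expr_div_n ler_pdivrMr ?exprn_gt0//.
  by rewrite -mulrA mulrC [_%:R * _]mulrC.
have -> : expR (- t) = expR (- (t / 2)) * expR (- (t / 2)).
  by rewrite -expRD; congr expR; field.
have -> : expR (- (1 / 2) * t) = expR (- (t / 2)) :> R.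
  by congr expR; field.
have -> : 2 * (2 ^+ n * n`!%:R) * (1 / 2 * expR (- (t / 2))) =
          2 ^+ n * n`!%:R * expR (t / 2) * (expR (- (t / 2)) * expR (- (t / 2))).
  by rewrite [in RHS]mulrA -[X in _ = X * _]mulrA -expRD subrr expR0; field.
rewrite ler_wpM2r ?mulr_ge0 ?expR_ge0//; apply: le_trans tn.
by rewrite -powR_mulrn//; apply: ler_powR.
Qed.

Lemma integrable_gamma_fun x : 0 < x ->
  mu.-integrable `]0, +oo[ (EFin \o gamma_fun x).
Proof.
move=> x0.
have m01 : measurable (`]0, 1]%classic : set R) by exact: measurable_itv.
have m1y : measurable (`]1, +oo[%classic : set R) by exact: measurable_itv.
have U : `]0, +oo[%classic = `]0, 1] `|` `]1, +oo[ :> set R.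
  by rewrite -itv_bndbnd_setU//= bnd_simp.
have mg (D : set R) : measurable_fun D (EFin \o gamma_fun x).
  by apply/measurable_EFinP; exact: measurable_gamma_fun.
apply/integrableP; split; first exact: mg.
rewrite U ge0_integral_setU//=; last 2 first.
- rewrite -U; apply/measurable_EFinP; apply: measurableT_comp => //.
  exact: measurable_gamma_fun.
- apply/eqP; apply/seteqP; split => // t []/=; rewrite !in_itv/= andbT => /andP[_ t1].
  by rewrite ltNge t1.
apply: lte_add_pinfty.
  apply: le_lt_trans (integral_powR_lty x x0).
  apply: ge0_le_integral => //.
  - apply/measurable_EFinP; apply: measurableT_comp => //.
    exact: measurable_gamma_fun.
  - by apply/measurable_EFinP; apply: measurable_funTS; exact: measurable_powR.
  - move=> t /=; rewrite in_itv/= => /andP[t0 _].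
    rewrite lee_fin ger0_norm ?gamma_fun_ge0// -[leRHS]mulr1.
    by rewrite ler_wpM2l ?powR_ge0// -expR0 ler_expR oppr_le0 ltW.
have [C C0 hC] := gamma_fun_exp_bound x.
suff /integrableP[] : mu.-integrable `]1, +oo[ (EFin \o gamma_fun x) by [].
apply: (@le_integrable _ _ R mu _ m1y _
  (fun t => C%:E * (EFin \o exponential_pdf (1 / 2)) t)%E (mg _)) => //.
- move=> t /=; rewrite in_itv/= andbT => /ltW t1.
  rewrite lee_fin ger0_norm ?gamma_fun_ge0//.
  by apply: le_trans (ler_norm _); exact: hC.
- apply: integrableZl => //.
  apply: (integrableS measurableT) => //.
  by apply: integrable_exponential_pdf; lra.
Qed.

(** On [1, 2] the integrand is at least exp(-2) / 2, because x > 0 gives t^(x-1) >= 1/t >= 1/2. *)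
Lemma Gamma_gt0 x : 0 < x -> 0 < Gamma x.
Proof.
move=> x0.
have I := integrable_gamma_fun x x0.
have S : (`[1, 2]%classic : set R) `<=` `]0, +oo[%classic .
  by move=> t /=; rewrite !in_itv/= andbT => /andP[t1 _]; exact: lt_le_trans t1.
have m12 : measurable (`[1, 2]%classic : set R) by exact: measurable_itv.
have mg (D : set R) : measurable_fun D (EFin \o gamma_fun x).
  by apply/measurable_EFinP; exact: measurable_gamma_fun.
rewrite -lte_fin /Gamma /Rintegral fineK; last exact: integrable_fin_num I.
apply: (@lt_le_trans _ _ (\int[mu]_(t in `[1%R, 2%R]) (gamma_fun x t)%:E)%E); last first.
  apply: ge0_subset_integral => //.
    exact: mg.
  by move=> t _; rewrite lee_fin gamma_fun_ge0.
have c0 : 0 < 2^-1 * expR (- 2) :> R by rewrite mulr_gt0 ?expR_gt0 ?invr_gt0.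
apply: (@lt_le_trans _ _ (\int[mu]_(t in `[1%R, 2%R]) (2^-1 * expR (- 2))%:E)%E).
  rewrite integral_cst//= lebesgue_measure_itv/= lte_fin ifT; last by lra.
  by rewrite -EFinB -EFinM lte_fin mulr_gt0//; lra.
apply: ge0_le_integral => //.
- exact: mg.
- move=> t /=; rewrite in_itv/= => /andP[t1 t2].
  rewrite lee_fin /gamma_fun ler_pM ?invr_ge0 ?expR_ge0//.
    apply: (@le_trans _ _ (t `^ (- 1))).
      by rewrite powR_inv1 ?lef_pV2 ?posrE//; lra.
    by apply: ler_powR => //; lra.
  by rewrite ler_expR lerN2.
Qed.

(* AM-GM on the integrands, weighted by [Gamma m / Gamma x], then integrated. *)
Lemma Gamma_midpoint x y : 0 < x -> 0 < y ->
  Gamma ((x + y) / 2) ^+ 2 <= Gamma x * Gamma y.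
Proof.
move=> x0 y0; set m := (x + y) / 2.
have m0 : 0 < m by rewrite /m; lra.
have Gx := Gamma_gt0 _ x0; have Gy := Gamma_gt0 _ y0; have Gm := Gamma_gt0 _ m0.
have Ix := integrable_gamma_fun _ x0; have Iy := integrable_gamma_fun _ y0.
have Im := integrable_gamma_fun _ m0.
(* With A, B, G the values of [Gamma] at [x], [y], [m], this weight turns the integrated inequality
   into G <= G/2 + A B / (2 G), that is G^2 <= A B. *)
pose l := Gamma m / Gamma x.
have l0 : 0 < l by exact: divr_gt0 Gm Gx.
have mO : measurable (`]0, +oo[%classic : set R) by exact: measurable_itv.
have amgm t : t \in `]0, +oo[ ->
    gamma_fun m t <= l / 2 * gamma_fun x t + l^-1 / 2 * gamma_fun y t.
  rewrite in_itv/= andbT => t0; rewrite /gamma_fun.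
  pose p := t `^ ((x - 1) / 2); pose q := t `^ ((y - 1) / 2).
  have t_neq0 : t != 0 by rewrite gt_eqF.
  have -> : t `^ (m - 1) = p * q.
    rewrite -powRD; last by apply/implyP.
    by congr (_ `^ _); rewrite /m; field.
  have -> : t `^ (x - 1) = p * p.
    rewrite -powRD; last by apply/implyP.
    by congr (_ `^ _); field.
  have -> : t `^ (y - 1) = q * q.
    rewrite -powRD; last by apply/implyP.
    by congr (_ `^ _); field.
  rewrite [leRHS](_ : _ = (l / 2 * (p * p) + l^-1 / 2 * (q * q)) * expR (- t)); last by ring.
  rewrite ler_wpM2r ?expR_ge0// -subr_ge0.
  rewrite [leRHS](_ : _ = l^-1 / 2 * (l * p - q) ^+ 2); last by field; rewrite gt_eqF.
  by rewrite mulr_ge0 ?sqr_ge0// divr_ge0 ?invr_ge0 ?ltW.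
have IZ z (k : R) : 0 < z ->
    mu.-integrable `]0, +oo[ (EFin \o (fun t => k * gamma_fun z t)).
  move=> z0; have := @integrableZl _ _ R mu _ mO k _ (integrable_gamma_fun z z0).
  by apply: eq_integrable => // t _; rewrite /= EFinM.
have : Gamma m <= l / 2 * Gamma x + l^-1 / 2 * Gamma y.
  rewrite /Gamma -!RintegralZl// -RintegralD//; [|exact: IZ..].
  apply: le_Rintegral => //.
  exact: (@integrableD _ _ R mu _ mO _ _ (IZ x (l / 2) x0) (IZ y (l^-1 / 2) y0)).
move: Gx Gy Gm; rewrite /l {amgm l0 l}.
move: (Gamma x) (Gamma y) (Gamma m) => A B G A0 B0 G0 h.
have : G <= A * B / G.
  suff <- : (G / A)^-1 / 2 * B * 2 = A * B / G.
    by move: h; have -> : G / A / 2 * A = G / 2; [field; rewrite gt_eqF | lra].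
  by field; rewrite !gt_eqF.
by rewrite ler_pdivlMr// expr2.
Qed.

End GammaFunction.

(** * Limits in R[i] through the real-valued modulus *)

(* The restated facts on [normc] are typed at the numClosedFieldType structure,
   where those of the library, typed at the structures of complex.v, fail to
   rewrite. *)
Section ComplexModulus.
Context {R : realType}.
Local Notation C := (R[i] : numClosedFieldType).
Implicit Types (z w : C) (e : R).

Lemma normE z : `|z| = (normc z)%:C%C.
Proof. by []. Qed.

Lemma normc_ge0 z : 0 <= normc z.
Proof. by case: z => a b; exact: sqrtr_ge0. Qed.

Lemma normc_zero : normc (0 : C) = 0.
Proof. exact: normc0. Qed.

Lemma normc_mul z w : normc (z * w) = normc z * normc w.
Proof. exact: normcM. Qed.

Lemma normc_inv z : normc z^-1 = (normc z)^-1.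
Proof. exact: normcV. Qed.

Lemma normc_addr_le z w : normc (z + w) <= normc z + normc w.
Proof. exact: le_normcD. Qed.

Lemma normc_opp z : normc (- z) = normc z.
Proof. exact: normcN. Qed.

Lemma normc_sub_le z w : normc (z - w) <= normc z + normc w.
Proof. by rewrite -(normc_opp w); exact: normc_addr_le. Qed.

Lemma normcBC z w : normc (z - w) = normc (w - z).
Proof. by rewrite -opprB normc_opp. Qed.

Lemma normc_dist_trans w z1 z2 :
  normc (z1 - z2) <= normc (z1 - w) + normc (w - z2).
Proof. by rewrite -[X in normc X](subrKA w); exact: normc_addr_le. Qed.

Lemma normc_exp z n : normc (z ^+ n) = normc z ^+ n.
Proof. by elim: n => [|n IH]; rewrite ?expr0 ?normc1// !exprS normc_mul IH. Qed.

Lemma normc_real (x : R) : normc (x%:C%C : C) = `|x|.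
Proof. by rewrite /normc /= expr0n/= addr0 sqrtr_sqr. Qed.

Lemma normc_nat n : normc (n%:R : C) = n%:R.
Proof.
have -> : (n%:R : C) = ((n%:R : R)%:C%C : C) by rewrite rmorph_nat.
by rewrite normc_real ger0_norm.
Qed.

Lemma normc_eq0 z : (normc z == 0) = (z == 0).
Proof.
by apply/eqP/eqP => [|->]; [exact: eq0_normc | exact: normc0].
Qed.

Lemma sqr_normcE z : normc z ^+ 2 = complex.Re z ^+ 2 + complex.Im z ^+ 2.
Proof. by case: z => a b /=; rewrite sqr_sqrtr// addr_ge0 ?sqr_ge0. Qed.

Lemma normc_Re_le z : `|complex.Re z| <= normc z.
Proof.
by case: z => a b /=; rewrite -sqrtr_sqr ler_sqrt ?addr_ge0 ?sqr_ge0// lerDl sqr_ge0.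
Qed.

Lemma normc_Im_le z : `|complex.Im z| <= normc z.
Proof.
by case: z => a b /=; rewrite -sqrtr_sqr ler_sqrt ?addr_ge0 ?sqr_ge0// lerDr sqr_ge0.
Qed.

Lemma normc_le_ReIm z : normc z <= `|complex.Re z| + `|complex.Im z|.
Proof.
rewrite [X in normc X]complexE; apply: le_trans (normc_addr_le _ _) _.
by rewrite normcM !normc_real /normc/= expr0n/= add0r expr1n sqrtr1 mul1r.
Qed.

(** Positive elements for the order of R[i] are real, so an epsilon for the complex norm is a real
    epsilon. *)
Lemma posC_real (e : C) : 0 < e -> exists2 d : R, 0 < d & e = d%:C%C.
Proof.
case: e => a b; rewrite ltcE /= => /andP[/eqP -> a0].
by exists a.
Qed.

Lemma cvgnCP (u : nat -> C) (l : C) :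
  (u @ \oo --> l) <->
  forall e, 0 < e -> \forall n \near \oo, normc (l - u n) < e.
Proof.
split => [/cvgrPdist_lt h e e0|h].
  have eC : 0 < (e%:C%C : C) by rewrite ltcR.
  by have := h _ eC; apply: filterS => n; rewrite normE ltcR.
apply/cvgrPdist_lt => e /posC_real[d d0 ->].
by apply: filterS (h _ d0) => n; rewrite normE ltcR.
Qed.

Lemma cvgn_normc_le (u : nat -> C) (l a : C) (B : R) :
  u @ \oo --> l -> (\forall n \near \oo, normc (u n - a) <= B) ->
  normc (l - a) <= B.
Proof.
move=> /cvgnCP ul uB; apply/ler_addgt0Pr => e e0.
near \oo => n.
have h1 : normc (l - u n) < e by near: n; exact: ul.
have h2 : normc (u n - a) <= B by near: n.
by have := normc_dist_trans (u n) l a; lra.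
Unshelve. all: by end_near. Qed.

Lemma cvgn_comb (u v : nat -> C) (l m a b : C) :
  u @ \oo --> l -> v @ \oo --> m ->
  (fun n => a * u n + b * v n) @ \oo --> a * l + b * m.
Proof.
move=> /cvgnCP ul /cvgnCP vm; apply/cvgnCP => e e0.
have a0 := normc_ge0 a; have b0 := normc_ge0 b.
pose K := normc a + normc b + 1.
have K0 : 0 < K by rewrite /K; lra.
have eK : 0 < e / K by rewrite divr_gt0.
near=> n.
have un : normc (l - u n) < e / K by near: n; exact: ul.
have vn : normc (m - v n) < e / K by near: n; exact: vm.
have -> : a * l + b * m - (a * u n + b * v n) = a * (l - u n) + b * (m - v n).
  by ring.
apply: le_lt_trans (normc_addr_le _ _) _; rewrite !normc_mul.
have h1 : normc a * normc (l - u n) <= normc a * (e / K) by rewrite ler_wpM2l// ltW.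
have h2 : normc b * normc (m - v n) <= normc b * (e / K) by rewrite ler_wpM2l// ltW.
apply: le_lt_trans (lerD h1 h2) _; rewrite -mulrDl.
have -> : normc a + normc b = K - 1 by rewrite /K addrK.
by rewrite mulrBl mulrCA divff ?gt_eqF// mulr1 mul1r gtrBl.
Unshelve. all: by end_near. Qed.

(** Comparison test: the real and imaginary parts converge absolutely as real series, and their
    limits are reassembled. *)
Lemma is_cvg_series_normc (u : nat -> C) (M : nat -> R) (B : R) :
  (forall k, normc (u k) <= M k) -> (forall n, \sum_(0 <= k < n) M k <= B) ->
  cvgn (series u).
Proof.
move=> uM MB.
have main (p : C -> R) : (forall z, `|p z| <= normc z) ->
    cvgn (series (fun k => p (u k))).
  move=> pn; apply: normed_cvg; apply: nondecreasing_is_cvgn.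
    by apply/nondecreasing_seqP => n; rewrite /normed_series_of /series/= big_nat_recr/= ?lerDl.
  exists B => _ [n _ <-]; apply: le_trans (MB n).
  by apply: ler_sum => k _; apply: le_trans (uM k); exact: pn.
have /cvgrPdist_lt hRe := main _ normc_Re_le.
have /cvgrPdist_lt hIm := main _ normc_Im_le.
set a := lim _ in hRe; set b := lim _ in hIm.
apply/cvg_ex; exists (Complex a b); apply/cvgnCP => e e0.
have e2 : 0 < e / 2 by rewrite divr_gt0.
have ReE n : complex.Re (series u n) = series (fun k => complex.Re (u k)) n.
  by rewrite /series/= (raddf_sum (@complex.Re R : Rcomplex R -> R)).
have ImE n : complex.Im (series u n) = series (fun k => complex.Im (u k)) n.
  by rewrite /series/= (raddf_sum (@complex.Im R : Rcomplex R -> R)).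
near=> n; apply: le_lt_trans (normc_le_ReIm _) _.
have -> : complex.Re (Complex a b - series u n) = a - series (fun k => complex.Re (u k)) n.
  by rewrite -ReE; case: (series u n).
have -> : complex.Im (Complex a b - series u n) = b - series (fun k => complex.Im (u k)) n.
  by rewrite -ImE; case: (series u n).
rewrite [ltRHS]splitr; apply: ltrD.
- by near: n; exact: hRe.
- by near: n; exact: hIm.
Unshelve. all: by end_near. Qed.

End ComplexModulus.

(** The set is a union of segments issued from 0, each a continuous image of [0, 1], and all of them
    share 0. *)
Lemma star_shaped_connected {R : realType}
  (S : set (R[i] : numClosedFieldType)) : star_shaped S -> connected S.
Proof.
move=> [S0 Sstar].
pose seg (w : R[i] : numClosedFieldType) (t : R) : (R[i] : numClosedFieldType) :=
  t%:C%C * w.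
have -> : S = \bigcup_(w in S) (seg w @` `[0, 1]).
  apply/seteqP; split => [w Sw|_ [w Sw [t t01 <-]]].
    by exists w => //; exists 1; rewrite /= ?in_itv/= ?ler01 ?lexx// /seg rmorph1 mul1r.
  by apply: Sstar => //; move: t01; rewrite /= in_itv.
apply: bigcup_connected.
  by exists 0 => w _; exists 0; rewrite /= ?in_itv/= ?lexx ?ler01// /seg rmorph0 mul0r.
move=> w _; apply: connected_continuous_connected; first exact: segment_connected.
apply: continuous_subspaceT => t.
apply/cvgrPdist_lt => _ /posC_real[e e0 ->].
have K0 : 0 < normc w + 1 by rewrite ltr_wpDl ?normc_ge0.
near=> u.
have tu : `|t - u| < e / (normc w + 1).
  by near: u; apply: (@cvgr_dist_lt _ _ _ _ _ id t) => //; rewrite divr_gt0.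
rewrite normE ltcR /seg -mulrBl -rmorphB normc_mul normc_real.
apply: (@le_lt_trans _ _ (`|t - u| * (normc w + 1))).
  by rewrite ler_wpM2l// lerDl.
by rewrite -ltr_pdivlMr.
Unshelve. all: by end_near. Qed.

(** * Series with weights dominated by the identity *)

(* The growth of the difference quotients of [z ^+ k.+1] on [|z| <= r]; the term
   of index 0 is left free, as [c 0 = 1] plays the role of the identity map. *)
Definition tame {R : realType} (r M : R) (x : nat -> R[i]) :=
  forall k, (0 < k)%N -> normc (x k) <= k.+1%:R * r ^+ k * M.

Section WeightedSum.
Context {R : realType}.
Local Notation C := (R[i] : numClosedFieldType).
Variables (c : nat -> R) (r q : R).
Hypotheses (c0 : c 0 = 1) (c_ge0 : forall k, 0 <= c k).
Hypothesis r_gt0 : 0 < r.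
Hypothesis cq : forall n, \sum_(1 <= k < n) c k * (k.+1%:R * r ^+ k) <= q.
Implicit Types (x y : nat -> C) (M : R).

Definition wsum x : C := limn (series (fun k => (c k)%:C%C * x k : C)).

Lemma q_ge0 : 0 <= q.
Proof. by have := cq 0; rewrite big_geq. Qed.

Lemma tame_ge0 M x : tame r M x -> 0 <= M.
Proof.
move=> /(_ 1%N isT) h.
have : 0 <= 2%:R * r ^+ 1 * M by apply: le_trans h; exact: normc_ge0.
by rewrite pmulr_rge0// mulr_gt0// exprn_gt0.
Qed.

Lemma tame_term M x k : tame r M x -> (0 < k)%N ->
  normc ((c k)%:C%C * x k) <= c k * (k.+1%:R * r ^+ k) * M.
Proof.
move=> tx k0; rewrite normc_mul normc_real ger0_norm// -mulrA ler_wpM2l//.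
exact: tx.
Qed.

Lemma wsum_cvg M x : tame r M x ->
  series (fun k => (c k)%:C%C * x k : C) @ \oo --> wsum x.
Proof.
move=> tx; have M0 := tame_ge0 _ _ tx.
(* [tame] says nothing at index 0, so that term is dominated by its own modulus. *)
pose B k := if k is 0 then normc (x 0%N) else c k * (k.+1%:R * r ^+ k) * M.
apply: (@is_cvg_series_normc _ _ B (normc (x 0%N) + q * M)).
  by case=> [|k]; [rewrite c0 mul1r | exact: tame_term].
case=> [|n]; first by rewrite big_geq// addr_ge0 ?normc_ge0 ?mulr_ge0// q_ge0.
rewrite big_ltn//= lerD2l.
rewrite (eq_big_nat _ _ (F2 := fun k => c k * (k.+1%:R * r ^+ k) * M)); last first.
  by case.
by rewrite -mulr_suml ler_wpM2r.
Qed.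

(** Since [c 0 = 1], the term of index 0 is exactly [x 0], and [q] controls the rest. Every later
    estimate on the series reduces through this bound to one on powers. *)
Lemma wsum_bound M x : tame r M x -> normc (wsum x - x 0%N) <= q * M.
Proof.
move=> tx; apply: cvgn_normc_le (wsum_cvg _ _ tx) _.
exists 1%N => // n /= n_gt0.
rewrite /series/= big_ltn// c0 mul1r addrC addKr.
apply: (@le_trans _ _ (\sum_(1 <= k < n) c k * (k.+1%:R * r ^+ k) * M)); last first.
  by rewrite -mulr_suml ler_wpM2r// (tame_ge0 _ _ tx).
rewrite !big_nat; elim/big_ind2 : _ => [|a A b B aA bB|k /andP[k0 _]].
- by rewrite (@normc_zero R).
- by apply: le_trans (normc_addr_le _ _) _; exact: lerD.
- exact: tame_term.
Qed.

Lemma wsum_comb M N x y (a b : C) : tame r M x -> tame r N y ->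
  wsum (fun k => a * x k + b * y k) = a * wsum x + b * wsum y.
Proof.
move=> /wsum_cvg cx /wsum_cvg cy; apply: cvg_lim; first exact: norm_hausdorff.
have -> : series (fun k => (c k)%:C%C * (a * x k + b * y k) : C) =
    (fun n => a * series (fun k => (c k)%:C%C * x k : C) n
            + b * series (fun k => (c k)%:C%C * y k : C) n).
  apply/funext => n; rewrite /series/= !mulr_sumr -big_split/=.
  by apply: eq_bigr => k _; ring.
exact: (cvgn_comb _ _ _ _ a b cx cy).
Qed.

End WeightedSum.

(* [L] stands for [wsum c]; keeping it a variable prevents conversion from
   unfolding the limit. *)
Section NearIdentity.
Context {R : realType}.
Local Notation C := (R[i] : numClosedFieldType).
Variables (L : (nat -> C) -> C) (r q : R).
Hypotheses (r_gt0 : 0 < r) (q_ge0 : 0 <= q) (q_lt1 : q < 1).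
Hypothesis L_comb : forall (M N : R) (x y : nat -> C) (a b : C),
  tame r M x -> tame r N y ->
  L (fun k => a * x k + b * y k) = a * L x + b * L y.
Hypothesis L_bound : forall (M : R) (x : nat -> C),
  tame r M x -> normc (L x - x 0%N) <= q * M.
Implicit Types (z w v : C).

(** * First and second order estimates on differences of powers *)

Lemma normc_exprD z w n : normc z <= r -> normc w <= r ->
  normc (z ^+ n.+1 - w ^+ n.+1) <= n.+1%:R * r ^+ n * normc (z - w).
Proof.
move=> zr wr; elim: n => [|n IH]; first by rewrite !expr1 expr0 !mul1r.
have -> : z ^+ n.+2 - w ^+ n.+2 =
    z * (z ^+ n.+1 - w ^+ n.+1) + (z - w) * w ^+ n.+1.
  by rewrite [z ^+ n.+2]exprS [w ^+ n.+2]exprS; ring.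
apply: le_trans (normc_addr_le _ _) _; rewrite !normc_mul normc_exp.
have h1 : normc z * normc (z ^+ n.+1 - w ^+ n.+1) <=
    r * (n.+1%:R * r ^+ n * normc (z - w)).
  by rewrite ler_pM ?normc_ge0.
have h2 : normc (z - w) * normc w ^+ n.+1 <= normc (z - w) * r ^+ n.+1.
  by rewrite ler_wpM2l ?normc_ge0// lerXn2r ?nnegrE ?normc_ge0// ltW.
apply: le_trans (lerD h1 h2) _.
by rewrite le_eqVlt; apply/orP; left; apply/eqP; rewrite -[in RHS](natr1 n.+1) exprS; ring.
Qed.

(** The Taylor remainder naturally carries a factor of order n^2; keeping both points in radius p <
    r trades one factor n for 1 / (r - p), so that the remainders form a [tame] sequence. In the
    induction, p and r - p add up to the new factor r. *)
Lemma normc_exprD2 (p : R) z h n : p < r -> normc z <= p -> normc (z + h) <= p ->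
  normc ((z + h) ^+ n.+1 - z ^+ n.+1 - n.+1%:R * z ^+ n * h)
    <= n.+1%:R * r ^+ n * (normc h ^+ 2 / (r - p)).
Proof.
move=> pr zp zhp; have rp : 0 < r - p by rewrite subr_gt0.
have p_ge0 : 0 <= p by apply: le_trans zp; exact: normc_ge0.
have H0 : 0 <= normc h ^+ 2 / (r - p) by rewrite divr_ge0 ?sqr_ge0 ?ltW.
elim: n => [|n IH].
  have -> : (z + h) ^+ 1 - z ^+ 1 - 1 * z ^+ 0 * h = 0 by ring.
  by rewrite (@normc_zero R) expr0 !mul1r.
have -> : (z + h) ^+ n.+2 - z ^+ n.+2 - n.+2%:R * z ^+ n.+1 * h =
    (z + h) * ((z + h) ^+ n.+1 - z ^+ n.+1 - n.+1%:R * z ^+ n * h)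
      + n.+1%:R * z ^+ n * h ^+ 2.
  rewrite [(z + h) ^+ n.+2]exprS [z ^+ n.+2]exprS [z ^+ n.+1]exprS.
  by rewrite -[n.+2%:R]natr1; ring.
apply: le_trans (normc_addr_le _ _) _; rewrite !normc_mul !normc_exp (@normc_nat R).
set E := normc (_ - _ - _) in IH *; set H := _ / _ in H0 IH *.
have h1 : normc (z + h) * E <= p * (n.+1%:R * r ^+ n * H).
  by rewrite ler_pM ?normc_ge0.
have h2 : n.+1%:R * normc z ^+ n * normc h ^+ 2 <= n.+1%:R * r ^+ n * (H * (r - p)).
  rewrite /H divfK ?gt_eqF// ler_wpM2r ?sqr_ge0// ler_wpM2l//.
  by rewrite lerXn2r ?nnegrE ?normc_ge0 ?(ltW r_gt0)// (le_trans zp)// ltW.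
apply: le_trans (lerD h1 h2) _.
have -> : p * (n.+1%:R * r ^+ n * H) + n.+1%:R * r ^+ n * (H * (r - p)) =
    n.+1%:R * r ^+ n.+1 * H by rewrite exprS; ring.
rewrite ler_wpM2r// ler_wpM2r ?exprn_ge0 ?(ltW r_gt0)//.
by rewrite ler_nat.
Qed.

(** * Near-identity series: Lipschitz bounds, derivative, local surjectivity, shrinking *)

Definition wseries z : C := L (fun k => z ^+ k.+1).
Local Notation f := wseries.

Lemma tame_exp z : normc z <= r -> tame r (normc z) (fun k => z ^+ k.+1).
Proof.
move=> zr k _; have := normc_exprD z 0 k zr.
by rewrite expr0n/= !subr0 (@normc_zero R); apply; exact: ltW.
Qed.

Lemma wseries0 : f 0 = 0.
Proof.
have t0 : tame r (normc (0 : C)) (fun k => (0 : C) ^+ k.+1).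
  by apply: tame_exp; rewrite (@normc_zero R) ltW.
have := L_bound _ _ t0; rewrite expr1 subr0 (@normc_zero R) mulr0 => h.
by apply/eqP; rewrite -normc_eq0 eq_le h normc_ge0.
Qed.

Lemma wseries_lip z w : normc z <= r -> normc w <= r ->
  normc (f z - f w - (z - w)) <= q * normc (z - w).
Proof.
move=> zr wr.
(* The coefficients 1 and -1 are kept explicit so that [L_comb] applies by rewriting. *)
have := L_bound (normc (z - w)) (fun k => 1 * z ^+ k.+1 + (-1) * w ^+ k.+1).
rewrite (L_comb _ _ _ _ _ _ (tame_exp _ zr) (tame_exp _ wr)).
rewrite !expr1 !mul1r !mulN1r; apply.
by move=> k _; rewrite mul1r mulN1r; exact: normc_exprD.
Qed.

Lemma wseries_dist z w : normc z <= r -> normc w <= r ->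
  (1 - q) * normc (z - w) <= normc (f z - f w).
Proof.
move=> zr wr; have := wseries_lip z w zr wr.
have := normc_sub_le (f z - f w) (f z - f w - (z - w)).
have -> : f z - f w - (f z - f w - (z - w)) = z - w by ring.
by lra.
Qed.

Lemma wseries_dist_le z w : normc z <= r -> normc w <= r ->
  normc (f z - f w) <= 2 * normc (z - w).
Proof.
move=> zr wr; have := wseries_lip z w zr wr.
have := normc_addr_le (f z - f w - (z - w)) (z - w); rewrite subrK.
have : q * normc (z - w) <= normc (z - w) by rewrite ler_piMl ?normc_ge0 ?ltW.
by lra.
Qed.

Lemma wseries_inj z w : normc z <= r -> normc w <= r -> f z = f w -> z = w.
Proof.
move=> zr wr fzw; have := wseries_dist z w zr wr.
rewrite fzw subrr (@normc_zero R) pmulr_rle0 ?subr_gt0// => h.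
by apply/eqP; rewrite -subr_eq0 -normc_eq0 eq_le h normc_ge0.
Qed.

(** The error of the linear approximation is [L] of the Taylor remainders of the powers, whose term
    of index 0 vanishes; hence [L_bound] makes it O(|h|^2). *)
Lemma is_derive_wseries z : normc z < r ->
  is_derive z 1 (f : C -> C) (L (fun k => k.+1%:R * z ^+ k)).
Proof.
move=> zr.
(* The midpoint leaves room for z + h inside radius [p], and a gap r - p for [normc_exprD2]. *)
pose p := (normc z + r) / 2.
have zp : normc z < p by rewrite /p; lra.
have pr : p < r by rewrite /p; lra.
set D := L _.
have tD : tame r 1 (fun k => k.+1%:R * z ^+ k : C).
  move=> k _; rewrite mulr1 normc_mul normc_exp (@normc_nat R).
  by rewrite ler_wpM2l// lerXn2r ?nnegrE ?normc_ge0 ?ltW.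
have key h : normc (z + h) <= p ->
    normc (f (z + h) - f z - D * h) <= q * (normc h ^+ 2 / (r - p)).
  move=> zhp.
  have tz : tame r (normc z) (fun k => z ^+ k.+1) by apply: tame_exp; exact: ltW.
  have tzh : tame r (normc (z + h)) (fun k => (z + h) ^+ k.+1).
    by apply: tame_exp; exact: le_trans zhp (ltW pr).
  have t1 : tame r (normc h) (fun k => 1 * (z + h) ^+ k.+1 + (-1) * z ^+ k.+1).
    move=> k _; rewrite mul1r mulN1r.
    have := normc_exprD (z + h) z k; rewrite addrAC subrr add0r; apply.
      exact: le_trans zhp (ltW pr).
    exact: ltW.
  have := L_bound (normc h ^+ 2 / (r - p))
    (fun k => 1 * (1 * (z + h) ^+ k.+1 + (-1) * z ^+ k.+1)
              + (- h) * (k.+1%:R * z ^+ k)).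
  rewrite (L_comb _ _ _ _ _ _ t1 tD) (L_comb _ _ _ _ _ _ tzh tz) -/D.
  rewrite !expr1 expr0 -/(f z) -/(f (z + h)).
  have -> : 1 * (1 * f (z + h) + -1 * f z) + - h * D
      - (1 * (1 * (z + h) + -1 * z) + - h * (1 * 1)) = f (z + h) - f z - D * h.
    by ring.
  apply=> k _.
  have -> : 1 * (1 * (z + h) ^+ k.+1 + -1 * z ^+ k.+1) + - h * (k.+1%:R * z ^+ k)
     = (z + h) ^+ k.+1 - z ^+ k.+1 - k.+1%:R * z ^+ k * h by ring.
  by apply: normc_exprD2 => //; exact: ltW.
have lim : (fun h : C => h^-1 *: (f (h *: 1 + z) - f z)) @ 0^' --> D.
  apply/cvgrPdist_lt => _ /posC_real[e e0 ->].
  (* q + 1 instead of q keeps [K] positive when q = 0. *)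
  pose K := (q + 1) / (r - p).
  have K0 : 0 < K.
    by rewrite divr_gt0 ?subr_gt0// ltr_wpDl.
  have d0 : 0 < Num.min (p - normc z) (e / K).
    by rewrite lt_min subr_gt0 zp divr_gt0.
  have dC : 0 < ((Num.min (p - normc z) (e / K))%:C%C : C) by rewrite ltcR.
  near=> h.
  have h0 : h != 0 by near: h; exact: nbhs_dnbhs_neq.
  have hd : normc h < Num.min (p - normc z) (e / K).
    rewrite -ltcR -[X in X < _]normE.
    by near: h; apply: dnbhs0_lt.
  have hp : normc h < p - normc z by apply: lt_le_trans hd _; rewrite ge_min lexx.
  have he : normc h < e / K by apply: lt_le_trans hd _; rewrite ge_min lexx orbT.
  have nh : 0 < normc h by rewrite lt_neqAle normc_ge0 eq_sym normc_eq0 h0.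
  rewrite normE ltcR.
  have -> : h *: 1 + z = z + h by rewrite /GRing.scale/= mulr1 addrC.
  have -> : D - h^-1 *: (f (z + h) - f z) = - (h^-1 * (f (z + h) - f z - D * h)).
    by rewrite /GRing.scale/=; field.
  rewrite normc_opp normc_mul normc_inv mulrC ltr_pdivrMr//.
  have zh : normc (z + h) <= p by have := normc_addr_le z h; lra.
  apply: le_lt_trans (key h zh) _.
  apply: (@le_lt_trans _ _ (K * normc h * normc h)).
    rewrite /K [leRHS](_ : _ = (q + 1) * (normc h ^+ 2 / (r - p))); last first.
      by field; rewrite gt_eqF// subr_gt0.
    rewrite ler_wpM2r ?divr_ge0 ?sqr_ge0 ?subr_ge0 ?ltW//.
    by rewrite ltrDl.
  by rewrite ltr_pM2r// mulrC -ltr_pdivlMr.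
apply: DeriveDef.
  by apply/cvg_ex; exists D.
by apply: cvg_lim lim.
Unshelve. all: by end_near. Qed.

Lemma derive1_wseries0 : derive1 (f : C -> C) 0 = 1.
Proof.
have d0 : is_derive (0 : C) (1 : C) (f : C -> C) (L (fun k => k.+1%:R * (0 : C) ^+ k)).
  by apply: is_derive_wseries; rewrite (@normc_zero R).
rewrite derive1E derive_val.
(* At 0 all terms of positive index vanish, so the constant 0 is allowed and [L_bound] pins the
   value to the term of index 0. *)
have t0 : tame r 0 (fun k => k.+1%:R * (0 : C) ^+ k).
  by move=> [//|k] _; rewrite exprS mul0r mulr0 (@normc_zero R) mulr0.
have := L_bound _ _ t0; rewrite expr0 mulr1 mulr0 => h.
by apply/eqP; rewrite -subr_eq0 -normc_eq0 eq_le h normc_ge0.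
Qed.

(* Banach iteration of [w |-> w + (y - f w)], a [q]-contraction. *)
Lemma wseries_surj z0 (s : R) (y : C) : 0 <= s -> normc z0 + s <= r ->
  normc (y - f z0) <= (1 - q) * s ->
  exists2 z : C, normc (z - z0) <= s & f z = y.
Proof.
move=> s_ge0 zsr yz0.
pose T w : C := w + (y - f w).
pose W n : C := iter n T z0.
have ball w : normc (w - z0) <= s -> normc w <= r.
  by move=> h; have := normc_addr_le (w - z0) z0; rewrite subrK; lra.
have ball0 : normc (z0 - z0) <= s by rewrite subrr (@normc_zero R).
have Tlip w w' : normc (w - z0) <= s -> normc (w' - z0) <= s ->
    normc (T w - T w') <= q * normc (w - w').
  move=> /ball hw /ball hw'; rewrite -normc_opp.
  have -> : - (T w - T w') = f w - f w' - (w - w') by rewrite /T; ring.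
  exact: wseries_lip.
have T0 : normc (T z0 - z0) <= (1 - q) * s by rewrite /T addrAC subrr add0r.
have inv n : normc (W n - z0) <= s.
  elim: n => [//|n IH].
  have h1 := Tlip _ _ IH ball0.
  have h2 := normc_dist_trans (T z0) (T (W n)) z0.
  have h3 : q * normc (W n - z0) <= q * s by rewrite ler_wpM2l.
  by rewrite /W iterS -/(W n); lra.
have step n : normc (W n.+1 - W n) <= q ^+ n * ((1 - q) * s).
  elim: n => [|n IH]; first by rewrite mul1r.
  apply: (@le_trans _ _ (q * normc (W n.+1 - W n))).
    exact: (Tlip _ _ (inv n.+1) (inv n)).
  by rewrite exprS -mulrA ler_wpM2l.
have sumE n : \sum_(0 <= k < n) q ^+ k * ((1 - q) * s) = (1 - q ^+ n) * s.
  elim: n => [|n IH]; first by rewrite big_geq// expr0 subrr mul0r.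
  by rewrite big_nat_recr//= IH exprS; ring.
(* The iterates are the partial sums of their increments, so convergence comes from the comparison
   test with a geometric series of sum at most [s]. *)
have cvW : cvgn (series (fun k => W k.+1 - W k)).
  apply: (is_cvg_series_normc _ _ s step) => n.
  by rewrite sumE ler_piMl// gerBl exprn_ge0.
have WE n : series (fun k => W k.+1 - W k) n = W n - z0.
  elim: n => [|n IH]; first by rewrite /series/= big_geq// subrr.
  by rewrite seriesSr IH addrC addrA subrK.
set l : C := limn (series (fun k => W k.+1 - W k)) in cvW.
have lC : forall e, 0 < e -> \forall n \near \oo,
    normc (l - series (fun k => W k.+1 - W k) n) < e by apply/cvgnCP.
have cW e : 0 < e -> \forall n \near \oo, normc (z0 + l - W n) < e.
  move=> e0; apply: filterS (lC e e0) => n; rewrite WE.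
  by have -> : l - (W n - z0) = z0 + l - W n by ring.
have zs : normc (z0 + l - z0) <= s.
  apply/ler_addgt0Pr => e e0; have [N _ /(_ N (leqnn N)) h] := cW e e0.
  by have := normc_dist_trans (W N) (z0 + l) z0; have := inv N; lra.
exists (z0 + l) => //.
(* y - f w equals T w - w, so it vanishes once the limit is shown to be fixed by [T], up to any
   epsilon. *)
suff : normc (y - f (z0 + l)) <= 0.
  move=> h; apply/eqP; rewrite eq_sym -subr_eq0 -normc_eq0 eq_le h.
  exact: normc_ge0.
apply/ler_addgt0Pr => e e0; rewrite add0r; have e2 : 0 < e / 2 by rewrite divr_gt0.
have [N _ hN] := cW _ e2.
have h1 := hN N (leqnn N); have h2 := hN N.+1 (leqnSn N).
have h3 := Tlip _ _ zs (inv N).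
have h4 : q * normc (z0 + l - W N) <= normc (z0 + l - W N).
  by rewrite ler_piMl ?normc_ge0 ?ltW.
have := normc_dist_trans (W N.+1) (T (z0 + l)) (z0 + l).
rewrite [normc (W N.+1 - _)]normcBC [X in normc X <= _](_ : _ = y - f (z0 + l)); last first.
  by rewrite /T; ring.
by move: h3; rewrite -[T (W N)]/(W N.+1); lra.
Qed.

(** The left side is L x - x 0 for the sequence x k = z^(k+1) (v^(k+1) - v + a). As |v| >= 1, its
    modulus is at most (k+1) |z v|^k |z| m, so only |z v| <= r matters for tameness. *)
Lemma wseries_twist z v (a : C) (m : R) : normc (z * v) <= r -> 1 <= normc v ->
  normc (v - 1) <= m -> normc a <= m ->
  normc (f (z * v) - v * f z + a * (f z - z)) <= q * (normc z * m).
Proof.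
move=> zvr v1 vm am.
have m0 : 0 <= m by apply: le_trans vm; exact: normc_ge0.
have zr : normc z <= r.
  by apply: le_trans zvr; rewrite normc_mul ler_peMr// normc_ge0.
have tz := tame_exp _ zr; have tzv := tame_exp _ zvr.
have := L_bound (normc z * m)
  (fun k => 1 * (z * v) ^+ k.+1 + (a - v) * z ^+ k.+1).
rewrite (L_comb _ _ _ _ _ _ tzv tz) -/(f z) -/(f (z * v)) !expr1.
have -> : 1 * f (z * v) + (a - v) * f z - (1 * (z * v) + (a - v) * z)
  = f (z * v) - v * f z + a * (f z - z) by ring.
apply=> k _.
have -> : 1 * (z * v) ^+ k.+1 + (a - v) * z ^+ k.+1 =
    z ^+ k.+1 * (v ^+ k.+1 - v + a) by rewrite exprMn; ring.
(* The factor is k and not k + 1: the remaining unit is spent on [a]. *)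
have vk : normc (v ^+ k.+1 - v) <= k%:R * normc v ^+ k * m.
  elim: k => [|k IH]; first by rewrite expr1 subrr (@normc_zero R) !mul0r.
  have -> : v ^+ k.+2 - v = v * (v ^+ k.+1 - v) + v * (v - 1).
    by rewrite [v ^+ k.+2]exprS; ring.
  apply: le_trans (normc_addr_le _ _) _; rewrite !normc_mul.
  have h1 : normc v * normc (v ^+ k.+1 - v) <= normc v * (k%:R * normc v ^+ k * m).
    by rewrite ler_wpM2l// normc_ge0.
  have h2 : normc v * normc (v - 1) <= normc v ^+ k.+1 * m.
    by rewrite ler_pM ?normc_ge0// exprS ler_peMr ?normc_ge0// exprn_ege1.
  apply: le_trans (lerD h1 h2) _.
  by rewrite le_eqVlt; apply/orP; left; apply/eqP; rewrite -[in RHS](natr1 k) exprS; ring.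
rewrite normc_mul normc_exp.
have va : normc (v ^+ k.+1 - v + a) <= k.+1%:R * normc v ^+ k * m.
  apply: le_trans (normc_addr_le _ _) _.
  have h : normc a <= normc v ^+ k * m.
    by apply: le_trans am _; rewrite ler_peMl// exprn_ege1.
  apply: le_trans (lerD vk h) _.
  by rewrite le_eqVlt; apply/orP; left; apply/eqP; rewrite -[in RHS](natr1 k); ring.
apply: (@le_trans _ _ (normc z ^+ k.+1 * (k.+1%:R * normc v ^+ k * m))).
  by rewrite ler_wpM2l// exprn_ge0// normc_ge0.
have -> : normc z ^+ k.+1 * (k.+1%:R * normc v ^+ k * m) =
    k.+1%:R * (normc (z * v)) ^+ k * (normc z * m).
  by rewrite normc_mul exprMn exprS; ring.
rewrite ler_wpM2r ?mulr_ge0 ?normc_ge0// ler_wpM2l//.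
by rewrite lerXn2r ?nnegrE ?normc_ge0 ?(ltW r_gt0).
Qed.

(* With [z' = z v] and [|v| > 1], the twisted bound gives [|v - t| <= |v - 1|],
   so [Re v <= (1 + t) / 2], while [v - 1 = O(1 - t)]; hence [|v| <= 1]. *)
Lemma wseries_modulus z z' (t : R) : normc z <= r -> normc z' <= r ->
  0 < t < 1 -> 1 - t <= ((1 - q) / 2) ^+ 2 -> f z' = t%:C%C * f z ->
  normc z' <= normc z.
Proof.
move=> zr z'r /andP[t0 t1] tq fz'.
have [z_eq0|z_neq0] := eqVneq z 0.
  suff -> : z' = 0 by rewrite z_eq0.
  apply: wseries_inj => //; first by rewrite (@normc_zero R) ltW.
  by rewrite fz' z_eq0 wseries0 mulr0.
have nz : 0 < normc z by rewrite lt_neqAle normc_ge0 eq_sym normc_eq0 z_neq0.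
pose v : C := z' / z.
have z'E : z' = z * v by rewrite /v mulrC divfK.
rewrite z'E normc_mul ler_piMr ?normc_ge0// leNgt; apply/negP => v1.
(* Otherwise the twist with a = v - t and m = |v - t| collapses to |z| |v - t| <= q |z| |v - t|.
   Then v = t, and |v - 1| <= |v - t| = 0 contradicts |v| > 1. *)
have vt : normc (v - t%:C%C) <= normc (v - 1).
  rewrite leNgt; apply/negP => /ltW h.
  have := @wseries_twist z v (v - t%:C%C) (normc (v - t%:C%C)).
  rewrite -z'E fz' => /(_ z'r (ltW v1) h (lexx _)).
  have -> : t%:C%C * f z - v * f z + (v - t%:C%C) * (f z - z) =
    - ((v - t%:C%C) * z) by ring.
  rewrite normc_opp normc_mul => hq.
  have : normc z * (1 - q) * normc (v - t%:C%C) <= 0 by lra.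
  rewrite pmulr_rle0; last by rewrite mulr_gt0// subr_gt0.
  move=> vt0; have : normc (v - 1) <= 0 by exact: le_trans h vt0.
  have := normc_addr_le (v - 1) 1; rewrite subrK.
  have -> : normc (1 : C) = 1 by rewrite -[1]/(1%:R) (@normc_nat R).
  by lra.
(* Both bounds on f are used: (1 - q) |z' - z| <= |f z' - f z| = (1 - t) |f z| <= 2 (1 - t) |z|. *)
have v1t : normc (v - 1) <= 2 * (1 - t) / (1 - q).
  rewrite ler_pdivlMr ?subr_gt0// -(ler_pM2r nz).
  have := wseries_dist _ _ z'r zr.
  have -> : z' - z = (v - 1) * z by rewrite z'E; ring.
  have -> : f z' - f z = (t - 1)%:C%C * f z by rewrite fz' rmorphB; ring.
  rewrite !normc_mul normc_real distrC ger0_norm ?subr_ge0 ?(ltW t1)//.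
  have := wseries_dist_le z 0 zr; rewrite (@normc_zero R) wseries0 !subr0.
  move=> /(_ (ltW r_gt0)) h.
  have : (1 - t) * normc (f z) <= (1 - t) * (2 * normc z).
    by rewrite ler_wpM2l// subr_ge0 ltW.
  by lra.
have ReB (s : R) : normc (v - s%:C%C) ^+ 2 =
    (complex.Re v - s) ^+ 2 + complex.Im v ^+ 2.
  by rewrite sqr_normcE; case: (v) => x y /=; rewrite subr0.
have Re_le : complex.Re v <= (1 + t) / 2.
  have : normc (v - t%:C%C) ^+ 2 <= normc (v - 1%:C%C) ^+ 2.
    by rewrite lerXn2r ?nnegrE ?normc_ge0.
  rewrite !ReB => h; have : (1 - t) * (2 * complex.Re v) <= (1 - t) * (1 + t) by lra.
  by rewrite ler_pM2l ?subr_gt0//; lra.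
(* The smallness of 1 - t enters here. Then |v|^2 = |v - 1|^2 + 2 Re v - 1 <= (1 - t) + (1 + t) - 1
   = 1. *)
have h1 : normc (v - 1) ^+ 2 <= 1 - t.
  apply: (@le_trans _ _ ((2 * (1 - t) / (1 - q)) ^+ 2)).
    by rewrite lerXn2r ?nnegrE ?normc_ge0// (le_trans (normc_ge0 _) v1t).
  have -> : (2 * (1 - t) / (1 - q)) ^+ 2 = (1 - t) * ((1 - t) / ((1 - q) / 2) ^+ 2).
    by field; rewrite gt_eqF// subr_gt0.
  rewrite ler_piMr// ?subr_ge0 ?(ltW t1)// ler_pdivrMr ?mul1r//.
  by rewrite exprn_gt0// divr_gt0// subr_gt0.
have h2 : 1 < normc v ^+ 2 by rewrite expr_gt1// normc_ge0.
have := ReB 1; have := ReB 0; rewrite subr0.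
move: h1 h2; rewrite -[v - 1]/(v - 1%:C%C) => h1 h2 e0 e1.
by rewrite e0 in h2; rewrite e1 in h1; lra.
Qed.

(** Surjectivity finds z' within r - s of z, hence in the disk of radius r where [wseries_modulus]
    applies and gives |z'| <= |z| <= s. As z' stays in the same disk, the step can be repeated with
    the same [d]. *)
Lemma wseries_shrink (s : R) : s < r -> exists2 d : R, 0 < d < 1 &
  forall z (t : R), normc z <= s -> 1 - d <= t <= 1 ->
    exists2 z' : C, normc z' <= s & f z' = t%:C%C * f z.
Proof.
move=> sr.
(* [d1] is the threshold of [wseries_modulus]; [d2] ensures (1 - t) |f z| <= 2 r (1 - t) <= (1 - q)
   (r - s), as surjectivity requires. The further bound 1/2 keeps t positive. *)
pose d1 := ((1 - q) / 2) ^+ 2; pose d2 := (1 - q) * (r - s) / (2 * r).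
have q1 : 0 < 1 - q by rewrite subr_gt0.
have rs : 0 < r - s by rewrite subr_gt0.
have d1_gt0 : 0 < d1 by rewrite exprn_gt0// divr_gt0.
have d2_gt0 : 0 < d2 by rewrite divr_gt0 ?mulr_gt0.
exists (Num.min (1 / 2) (Num.min d1 d2)).
  rewrite !lt_min d1_gt0 d2_gt0 divr_gt0//= gt_min.
  by apply/orP; left; lra.
move=> z t zs /andP[td t1].
have : 1 - t <= Num.min (1 / 2) (Num.min d1 d2) by lra.
rewrite !le_min => /and3P[th td1 td2].
have zr : normc z <= r by apply: le_trans zs (ltW sr).
have [->|t_neq1] := eqVneq t 1; first by exists z; rewrite ?mul1r.
have t01 : 0 < t < 1 by rewrite [t < 1]lt_neqAle t_neq1 t1 andbT; lra.
have [] := wseries_surj z (r - s) (t%:C%C * f z).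
- exact: ltW.
- by lra.
- have -> : t%:C%C * f z - f z = (t - 1)%:C%C * f z by rewrite rmorphB; ring.
  rewrite normc_mul normc_real distrC ger0_norm ?subr_ge0//.
  have := wseries_dist_le z 0 zr; rewrite (@normc_zero R) wseries0 !subr0.
  move=> /(_ (ltW r_gt0)) h.
  apply: (@le_trans _ _ (d2 * (2 * r))); last by rewrite /d2 divfK// gt_eqF// mulr_gt0.
  apply: ler_pM => //; [by rewrite subr_ge0|exact: normc_ge0|].
  by apply: le_trans h _; rewrite ler_pM2l.
move=> z' z'z fz'; exists z' => //.
have z'r : normc z' <= r by have := normc_addr_le (z' - z) z; rewrite subrK; lra.
by apply: le_trans zs; exact: wseries_modulus fz'.
Qed.

Lemma wseries_star z (t : R) : normc z < r -> 0 <= t <= 1 ->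
  exists2 z' : C, normc z' < r & f z' = t%:C%C * f z.
Proof.
move=> zr /andP[t0 t1].
have [->|t_neq0] := eqVneq t 0.
  by exists 0; rewrite ?(@normc_zero R)// wseries0 mul0r.
have t_gt0 : 0 < t by rewrite lt_neqAle eq_sym t_neq0.
have [d /andP[d0 d1] shrink] := wseries_shrink _ zr.
have e01 : 0 < 1 - d by rewrite subr_gt0.
(* [n] shrinkings reach every factor down to (1 - d)^n: when u < 1 - d, first realise u / (1 - d),
   then shrink once more by 1 - d. *)
have iterate n : forall w (u : R), normc w <= normc z -> (1 - d) ^+ n <= u <= 1 ->
    exists2 z' : C, normc z' <= normc z & f z' = u%:C%C * f w.
  elim: n => [|n IH] w u wz /andP[nu u1].
    exists w => //; have -> : u = 1.
      by apply/le_anti/andP; split; last by rewrite expr0 in nu.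
    by rewrite rmorph1 mul1r.
  have [du|ud] := leP (1 - d) u; first by apply: shrink => //; rewrite du.
  have [|w' w'z fw'] := IH w (u / (1 - d)) wz.
    by rewrite ler_pdivlMr// -exprSr nu ler_pdivrMr// mul1r ltW.
  have [|z' z'z fz'] := shrink w' (1 - d) w'z; first by rewrite lexx gerBl ltW.
  by exists z' => //; rewrite fz' fw' mulrA -rmorphM [(1 - d) * _]mulrC divfK// gt_eqF.
have [n nt] : exists n, (1 - d) ^+ n <= t.
  have : (fun n => (1 - d) ^+ n) @ \oo --> (0 : R).
    by apply: cvg_expr; rewrite ger0_norm ?ltW// gtrBl.
  move=> /cvgrPdist_lt /(_ t t_gt0) [n _ /(_ n (leqnn n))].
  rewrite sub0r normrN => h; exists n; apply: ltW; apply: le_lt_trans h.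
  exact: ler_norm.
have [|z' z'z fz'] := iterate n z t (lexx _); first by rewrite nt.
by exists z' => //; exact: le_lt_trans zr.
Qed.


(** * Image of the disk: star-shaped, open, connected *)

Lemma mem_disk (z : C) : disk r z <-> normc z < r.
Proof. by rewrite /disk/= normE ltcR. Qed.

Lemma wseries_image_star_shaped : star_shaped (f @` disk r).
Proof.
split; first by exists 0; [apply/mem_disk; rewrite (@normc_zero R) | exact: wseries0].
move=> _ t [z /mem_disk zr <-] t01.
by have [z' /mem_disk z'r fz'] := wseries_star z t zr t01; exists z'.
Qed.

Lemma wseries_image_open : open (f @` disk r).
Proof.
rewrite openE => _ [z /mem_disk zr <-]; rewrite /interior.
pose s := (r - normc z) / 2.
have s0 : 0 < s by rewrite divr_gt0// subr_gt0.
have e0 : 0 < (1 - q) * s by rewrite mulr_gt0// subr_gt0.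
apply/nbhs_ballP; exists (((1 - q) * s)%:C%C); first by rewrite /= ltcR.
move=> y; rewrite -ball_normE/= normE ltcR normcBC => yz.
have [||z' z'z fz'] := wseries_surj z s y (ltW s0); first by rewrite /s; lra.
  exact: ltW.
exists z' => //; apply/mem_disk.
by have := normc_addr_le (z' - z) z; rewrite subrK; move: z'z; rewrite /s; lra.
Qed.

Lemma starlike_wseries : starlike_on (disk r) f.
Proof.
have sS := wseries_image_star_shaped.
split.
- split.
    by move=> z /mem_disk zr; have [] := is_derive_wseries z zr.
  move=> z w; rewrite !inE => /mem_disk zr /mem_disk wr.
  by apply: wseries_inj; exact: ltW.
- exact: wseries0.
- exact: derive1_wseries0.
- split; first by exists 0; case: sS.
    exact: wseries_image_open.
  exact: star_shaped_connected.
- exact: sS.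
Qed.

End NearIdentity.

(** Links the constant e - 1 of (iii) to the 10/9 of the coefficient sum; e >= (1 + 1/2)^2 = 9/4 is
    enough. *)
Lemma expR1B1_ge {R : realType} : 10 / 9 <= expR 1 - 1 :> R.
Proof.
have h : 3 / 2 <= expR (1 / 2) :> R.
  by apply: le_trans (expR_ge1Dx _); lra.
have -> : expR 1 = expR (1 / 2) * expR (1 / 2) :> R.
  by rewrite -expRD; congr expR; field.
have : (3 / 2) * (3 / 2) <= expR (1 / 2) * expR (1 / 2) :> R by rewrite ler_pM.
lra.
Qed.

(** * Coefficients with log-convex denominators *)

Section LogConvexCoefficients.
Context {R : realType}.
Variable D : nat -> R.
Hypothesis D_gt0 : forall k, 0 < D k.
Hypothesis D_log_convex : forall k, D k.+1 ^+ 2 <= D k * D k.+2.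
Hypothesis D23 : 2 * D 2 < D 3.

(** Log-convexity makes the ratios D (k+1) / D k nondecreasing, so the doubling from index 2 to 3
    persists. *)
Lemma D_double k : 2 * D k.+2 <= D k.+3.
Proof.
elim: k => [|k IH]; first exact: ltW.
rewrite -(ler_pM2l (D_gt0 k.+2)); apply: le_trans (D_log_convex k.+2).
by rewrite expr2 mulrCA mulrA ler_pM2r.
Qed.

Lemma D_geometric k : D 2 * 2 ^+ k <= D k.+2.
Proof.
elim: k => [|k IH]; first by rewrite mulr1.
by rewrite exprS mulrCA; apply: le_trans (D_double k); rewrite ler_pM2l.
Qed.

(* [10 / 9] is the sum over [k >= 2] of [4 (k + 1) / 4 ^ k]. *)
Lemma weighted_coef_sum_le n :
  \sum_(1 <= k < n) D 0 / D k * (k.+1%:R * (1 / 2) ^+ k)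
    <= D 0 / D 1 + 10 / 9 * (D 0 / D 2).
Proof.
have c_gt0 k : 0 < D 0 / D k by rewrite divr_gt0.
have q_ge0 : 0 <= D 0 / D 1 + 10 / 9 * (D 0 / D 2).
  by apply: addr_ge0; [exact: ltW | rewrite mulr_ge0 ?divr_ge0// ltW].
case: n => [|[|m]]; [by rewrite big_geq..|].
have c_le k : D 0 / D k.+2 <= D 0 / D 2 * (1 / 2) ^+ k.
  rewrite div1r exprVn -mulrA ler_pM2l// -invfM lef_pV2 ?posrE//.
    exact: D_geometric.
  by rewrite mulr_gt0// exprn_gt0.
(* The subtracted term is the tail over k >= m + 2 of the majorant, (m/3 + 10/9) / 4^m; with it the
   induction step becomes an identity. The weight at k = 1 is 2 / 2 = 1, whence D 0 / D 1 alone. *)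
suff : \sum_(1 <= k < m.+2) D 0 / D k * (k.+1%:R * (1 / 2) ^+ k) <=
    D 0 / D 1 + D 0 / D 2 * (10 / 9 - (m%:R / 3 + 10 / 9) * ((1 / 2) ^+ m) ^+ 2).
  move=> h; apply: le_trans h _; rewrite lerD2l mulrC ler_pM2r//.
  by rewrite gerBl mulr_ge0 ?sqr_ge0// addr_ge0// divr_ge0.
elim: m => [|m IH].
  rewrite big_nat1 expr1 expr0 expr1n mul0r add0r mulr1 subrr mulr0 addr0.
  by rewrite le_eqVlt; apply/orP; left; apply/eqP; field; rewrite gt_eqF.
rewrite big_nat_recr//=.
set p := (1 / 2) ^+ m in IH *.
have p_gt0 : 0 < p by rewrite exprn_gt0// divr_gt0.
have h : D 0 / D m.+2 * (m.+3%:R * (1 / 2) ^+ m.+2) <=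
    D 0 / D 2 * p * (m.+3%:R * (1 / 2) ^+ m.+2).
  apply: ler_wpM2r; last exact: c_le.
  by rewrite mulr_ge0// exprn_ge0// divr_ge0.
apply: le_trans (lerD IH h) _.
rewrite le_eqVlt; apply/orP; left; apply/eqP.
rewrite !exprS -/p -[m.+3]addn3 -[m.+1]addn1 !natrD.
by field; rewrite !gt_eqF.
Qed.

Lemma starlike_log_convex : D 0 / D 1 + (expR 1 - 1) * (D 0 / D 2) < 1 ->
  starlike_on (disk (1 / 2)) (wseries (wsum (fun k => D 0 / D k))).
Proof.
move=> lt1.
have q_lt1 : D 0 / D 1 + 10 / 9 * (D 0 / D 2) < 1.
  apply: le_lt_trans lt1; rewrite lerD2l; apply: ler_wpM2r expR1B1_ge.
  by rewrite divr_ge0 ?ltW.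
have c0 : D 0 / D 0 = 1 by rewrite divff// gt_eqF.
have c_ge0 k : 0 <= D 0 / D k by rewrite divr_ge0 ?ltW.
have r_gt0 : 0 < 1 / 2 :> R by rewrite divr_gt0.
apply: (@starlike_wseries _ _ _ (D 0 / D 1 + 10 / 9 * (D 0 / D 2))) => //.
- exact: q_ge0 weighted_coef_sum_le.
- by move=> M N x y u v tx ty;
    exact: (wsum_comb _ _ _ c0 c_ge0 r_gt0 weighted_coef_sum_le _ _ _ _ _ _ tx ty).
- by move=> M x tx;
    exact: (wsum_bound _ _ _ c0 c_ge0 r_gt0 weighted_coef_sum_le _ _ tx).
Qed.

End LogConvexCoefficients.

(** * Application to the Wright function *)

Lemma log_convexM {R : realDomainType} (x0 x1 x2 y0 y1 y2 : R) :
  x1 ^+ 2 <= x0 * x2 -> y1 ^+ 2 <= y0 * y2 ->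
  (x1 * y1) ^+ 2 <= x0 * y0 * (x2 * y2).
Proof. by move=> hx hy; rewrite exprMn (mulrACA x0); apply: ler_pM; rewrite ?sqr_ge0. Qed.

Lemma ltr_cross_double {R : realFieldType} (x y z w : R) : 0 < y -> 0 < w ->
  x / y < z / (2 * w) -> 2 * (x * w) < y * z.
Proof.
by move=> y0 w0; rewrite ltr_pdivrMr// mulrAC ltr_pdivlMr ?mulr_gt0//; lra.
Qed.

Lemma ltr_split {R : realFieldType} (x y z w e : R) :
  x * y / z - (1 - e) * x * y / w < 1 -> x * y / z + (e - 1) * (x * y / w) < 1.
Proof. lra. Qed.

Theorem theorem3p6 (R : realType) (a b mu nu : R)
    (a_gt0 : 0 < a) (b_gt0 : 0 < b) (mu_gt0 : 0 < mu) (nu_gt0 : 0 < nu)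
    (cond_i : Gamma (a + 2 * mu) / Gamma (a + 3 * mu)
              < Gamma (b + 3 * nu) / (2 * Gamma (b + 2 * nu)))
    (cond_ii : Gamma (a + mu) * Gamma (a + 3 * mu) / Gamma (a + 2 * mu) ^+ 2
               < 2 * Gamma (b + 2 * nu) ^+ 2
                 / (Gamma (b + nu) * Gamma (b + 3 * nu)))
    (cond_iii : Gamma a * Gamma b / (Gamma (a + mu) * Gamma (b + nu))
                - (1 - expR 1) * Gamma a * Gamma b
                  / (Gamma (a + 2 * mu) * Gamma (b + 2 * nu)) < 1) :
  starlike_on (disk (1 / 2)) (wright mu a nu b).
Proof.
pose D (k : nat) := Gamma (a + k%:R * mu) * Gamma (b + k%:R * nu).
have arg_gt0 (s t : R) (k : nat) : 0 < s -> 0 < t -> 0 < s + k%:R * t.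
  by move=> s0 t0; rewrite ltr_pwDl// mulr_ge0// ltW.
have G_gt0 (s t : R) (k : nat) : 0 < s -> 0 < t -> 0 < Gamma (s + k%:R * t).
  by move=> s0 t0; apply/Gamma_gt0/arg_gt0.
have D_gt0 k : 0 < D k by exact: mulr_gt0 (G_gt0 a mu k _ _) (G_gt0 b nu k _ _).
have G_mid (s t : R) (k : nat) : 0 < s -> 0 < t ->
    Gamma (s + k.+1%:R * t) ^+ 2 <= Gamma (s + k%:R * t) * Gamma (s + k.+2%:R * t).
  move=> s0 t0.
  (* The arguments are in arithmetic progression, so each is the midpoint of its neighbours. *)
  have -> : s + k.+1%:R * t = (s + k%:R * t + (s + k.+2%:R * t)) / 2.
    by rewrite -[k.+2]addn2 -[k.+1]addn1 !natrD; field.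
  by apply: Gamma_midpoint; exact: arg_gt0.
have D_log_convex k : D k.+1 ^+ 2 <= D k * D k.+2.
  exact: log_convexM (G_mid a mu k _ _) (G_mid b nu k _ _).
have D0 : D 0 = Gamma a * Gamma b by rewrite /D !mul0r !addr0.
have D1 : D 1 = Gamma (a + mu) * Gamma (b + nu) by rewrite /D !mul1r.
have D23 : 2 * D 2 < D 3.
  exact: ltr_cross_double (G_gt0 a mu 3 _ _) (G_gt0 b nu 2 _ _) cond_i.
have -> : wright mu a nu b = wseries (wsum (fun k => D 0 / D k)).
  by rewrite D0.
by apply: starlike_log_convex => //; rewrite D0 D1; exact: ltr_split cond_iii.
Qed.
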